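(* Let $G:\ell_1\to\ell_\infty$ be Gossez's operator, $(Gx)_n=-\sum_{k<n}x_k+\sum_{k>n}x_k$ for $x=(x_k)_{k\in\mathbb N}\in\ell_1$, $n\in\mathbb N$. With respect to the duality $(\ell_1,\ell_\infty)$ the operator $G$ is maximal monotone and $$\varphi_G=\psi_G=\iota_{\operatorname{Graph}G}=c_G .$$ Likewise, the operator $\neg G:\ell_1\to\ell_\infty$, $(\neg G)(x)=-Gx$, is maximal monotone with respect to the duality $(\ell_1,\ell_\infty)$ and $$\varphi_{\neg G}=\psi_{\neg G}=\iota_{\operatorname{Graph}(\neg G)}=c_{\neg G}.$$
   Context: All spaces are real. $\ell_1$ is the space of absolutely summable real sequences, $\ell_\infty$ the space of bounded real sequences; $Z:=\ell_1\times\ell_\infty$ and the coupling is $c(x,y)=\langle x,y\rangle=\sum_{n\in\mathbb N}x_ny_n$ for $(x,y)\in Z$. For $z=(x,y),\ w=(u,v)\in Z$ put $z\cdot w:=\langle x,v\rangle+\langle u,y\rangle$. For $f:Z\to\overline{\mathbb R}$, its conjugate is $f^\square(z)=\sup\{z\cdot z'-f(z')\mid z'\in Z\}$, $z\in Z$. For $A\subset Z$: $\iota_A(z)=0$ if $z\in A$ and $+\infty$ otherwise; $c_A:=c+\iota_A$; the Fitzpatrick function of $A$ is $\varphi_A(z):=c_A^\square(z)=\sup\{z\cdot w-c(w)\mid w\in A\}$; and $\psi_A:=\varphi_A^\square=c_A^{\square\square}$. For an operator $T:\ell_1\rightrightarrows\ell_\infty$, $c_T,\varphi_T,\psi_T$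 denote $c_A,\varphi_A,\psi_A$ with $A=\operatorname{Graph}T$. $T$ is monotone if $\langle x_1-x_2,y_1-y_2\rangle\ge0$ for all $y_1\in T(x_1)$, $y_2\in T(x_2)$, and maximal monotone (with respect to the duality $(\ell_1,\ell_\infty)$) if its graph is maximal, under inclusion, among the monotone subsets of $\ell_1\times\ell_\infty$. *)

(* Defs.v *)
From HB Require Import structures.
From mathcomp Require Import all_boot all_order all_algebra.
From mathcomp Require Import all_classical all_reals all_analysis.

Set Implicit Arguments.
Unset Strict Implicit.
Unset Printing Implicit Defensive.

Import Order.TTheory GRing.Theory Num.Theory.
Import numFieldNormedType.Exports.

Local Open Scope classical_set_scope.
Local Open Scope ring_scope.

Section SequenceSpaces.
Variable R : realType.

Definition absolutely_summable : {pred R^nat} :=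
  mem [set x : R^nat | cvgn [normed series x]].

Definition bounded_sequence : {pred R^nat} :=
  mem [set y : R^nat | bounded_fun y].

Lemma absolutely_summable_submod_closed : submod_closed absolutely_summable.
Proof.
split.
  rewrite inE /= (_ : [normed series _] = cst 0); first exact: is_cvg_cst.
  by apply/funext => n; rewrite /= seriesEnat /= big1// => i _; rewrite normr0.
move=> a x y /[!inE]/= xs ys.
apply: (@series_le_cvg _ _ (`|a| *: (fun n => `|x n|) + (fun n => `|y n|))).
- by move=> n; exact: normr_ge0.
- by move=> n; rewrite addr_ge0// mulr_ge0.
- by move=> n; rewrite (le_trans (ler_normD _ _))// lerD2r normrM.
- by apply: is_cvg_seriesD => //; exact: is_cvg_seriesZ.
Qed.

Lemma bounded_sequenceP (y : R^nat) :
  y \in bounded_sequence <-> exists M, forall n, `|y n| <= M.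
Proof.
have PF : ProperFilter (globally [set: nat]) by
  exact: (@globally_properfilter _ _ 0%N).
rewrite inE /=; split=> [/ex_bound[M yM]|[M yM]].
  by exists M => n; exact: yM.
by apply/ex_bound; exists M => n _; exact: yM.
Qed.

Lemma bounded_sequence_submod_closed : submod_closed bounded_sequence.
Proof.
split; first by apply/bounded_sequenceP; exists 0 => n; rewrite normr0.
move=> a x y /bounded_sequenceP[M xM] /bounded_sequenceP[N yN].
apply/bounded_sequenceP; exists (`|a| * M + N) => n.
by rewrite (le_trans (ler_normD _ _))// lerD// normrM ler_wpM2l.
Qed.

HB.instance Definition _ := GRing.isSubmodClosed.Build R R^nat
  absolutely_summable absolutely_summable_submod_closed.

HB.instance Definition _ := GRing.isSubmodClosed.Build R R^nat
  bounded_sequence bounded_sequence_submod_closed.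

Record ell1 := Ell1 {
  ell1_seq :> nat -> R;
  ell1P : ell1_seq \in absolutely_summable }.

Record ellinfty := Ellinfty {
  ellinfty_seq :> nat -> R;
  ellinftyP : ellinfty_seq \in bounded_sequence }.

HB.instance Definition _ := [isSub of ell1 for ell1_seq].
HB.instance Definition _ := [Choice of ell1 by <:].
HB.instance Definition _ := [SubChoice_isSubLmodule of ell1 by <:].

HB.instance Definition _ := [isSub of ellinfty for ellinfty_seq].
HB.instance Definition _ := [Choice of ellinfty by <:].
HB.instance Definition _ := [SubChoice_isSubLmodule of ellinfty by <:].

End SequenceSpaces.

Section Duality.
Variable R : realType.

Notation Z := (ell1 R * ellinfty R)%type.

(* limn is total; the series converges absolutely since x is summable and y is
   bounded, so that this is its sum. *)
Definition pairing (x : ell1 R) (y : ellinfty R) : R :=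
  limn [series x n * y n]_n.

Definition coupling (z : Z) : R := pairing z.1 z.2.

Definition dot (z w : Z) : R := pairing z.1 w.2 + pairing w.1 z.2.

Local Open Scope ereal_scope.

(* With the conventions on \bar R, r%:E - +oo = -oo and r%:E - -oo = +oo. *)
Definition conjugate (f : Z -> \bar R) (z : Z) : \bar R :=
  ereal_sup [set (dot z w)%:E - f w | w in [set: Z]].

Definition iota_ (A : set Z) (z : Z) : \bar R :=
  if z \in A then 0 else +oo.

Definition coupling_on (A : set Z) (z : Z) : \bar R :=
  (coupling z)%:E + iota_ A z.

Definition fitzpatrick (A : set Z) : Z -> \bar R := conjugate (coupling_on A).

Definition psi (A : set Z) : Z -> \bar R := conjugate (fitzpatrick A).

Local Close Scope ereal_scope.

Definition graph (T : ell1 R -> set (ellinfty R)) : set Z :=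
  [set z | T z.1 z.2].

Definition monotone_set (A : set Z) : Prop :=
  forall z w, A z -> A w -> 0 <= pairing (z.1 - w.1) (z.2 - w.2).

Definition maximal_monotone (T : ell1 R -> set (ellinfty R)) : Prop :=
  monotone_set (graph T) /\
  forall B, monotone_set B -> graph T `<=` B -> B = graph T.

Definition operator_of (F : ell1 R -> ellinfty R) :
  ell1 R -> set (ellinfty R) := fun x => [set F x].

End Duality.

Section Gossez.
Variable R : realType.

(* For summable x the tail series converges, and the limit is its sum. *)
Definition gossez_seq (x : R^nat) : R^nat := fun n =>
  - (\sum_(0 <= k < n) x k) + limn [sequence \sum_(n.+1 <= k < m) x k]_m.

Lemma gossez_seq_bounded (x : ell1 R) :
  gossez_seq x \in @bounded_sequence R.
Proof.
have xs := ell1P x; rewrite inE /= in xs.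
have xc := normed_cvg xs.
have nd : nondecreasing_seq [normed series x].
  by apply: nondecreasing_series => n _ _; exact: normr_ge0.
have le_lim n : `|series x n| <= limn [normed series x].
  exact: le_trans (ler_norm_sum _ _ _) (nondecreasing_cvgn_le nd xs n).
apply/bounded_sequenceP; exists (limn [normed series x] *+ 3) => n.
rewrite !mulrS mulr0n addr0 (le_trans (ler_normD _ _))//.
rewrite normrN lerD//; first exact: le_lim.
have tc : cvgn (fun m => \sum_(n.+1 <= k < m) x k).
  by rewrite (is_cvg_series_restrict n.+1 x).
rewrite -lim_norm//; apply: limr_le; first exact: is_cvg_norm.
near=> m.
rewrite /= -sub_series_geq; last by near: m; exact: nbhs_infty_ge.
by rewrite (le_trans (ler_normB _ _))// lerD.
Unshelve. all: by end_near.
Qed.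

Definition gossez (x : ell1 R) : ellinfty R := Ellinfty (gossez_seq_bounded x).

Definition neg_gossez (x : ell1 R) : ellinfty R := - gossez x.

End Gossez.

(* Main.v *)
Require Import Defs.
From mathcomp Require Import all_boot all_order all_algebra.
From mathcomp Require Import all_classical all_reals all_analysis.
From mathcomp Require Import ring lra.

(** Everything follows from one property of the operators [F] at hand, their
    skewness: [<u, F v> = - <v, F u>] for all summable [u] and [v].

    Skewness gives [<u, F u> = 0], so the coupling vanishes on the graph of [F]
    and [c_F] is the indicator of the graph.  For a point [z = (x, y)] and a
    point [w = (u, F u)] of the graph it also gives
    [z . w = <x, F u> + <u, y> = <u, y - F x>].  As [u] runs over the whole of
    ell^1, this linear functional of [u] has supremum [0] when [y = F x] and
    [+oo] otherwise, because the pairing separates the points of ell^oo.  Thus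
    the indicator of the graph is its own conjugate ([conjugate_iota_skew]);
    applied once, this computes the Fitzpatrick function, and applied twice,
    psi.  Likewise, [(x, y)] is monotonically related to the graph if and only
    if [<u, y - F x> <= <x, y>] for all [u], which forces [y = F x]: this is
    maximality ([maximal_monotone_skew]).

    Gossez's operator is skew by a summation by parts ([gossez_skew]): the
    partial sums of the series [<u, G v> + <v, G u>] have a closed form in the
    partial sums of [u] and [v], which tends to [0]; its opposite is then skew
    too. *)

Set Implicit Arguments.
Unset Strict Implicit.
Unset Printing Implicit Defensive.

Import Order.TTheory GRing.Theory Num.Theory.
Import numFieldNormedType.Exports.

Local Open Scope classical_set_scope.
Local Open Scope ring_scope.

Section Pairing.
Variable R : realType.
Implicit Types (x u v : ell1 R) (y w : ellinfty R).

Lemma ell1_cvg_series x : cvgn (series x).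
Proof. by apply: normed_cvg; have := ell1P x; rewrite inE. Qed.

Lemma cvg_pairing x y : [series x n * y n]_n @ \oo --> pairing x y.
Proof.
suff : cvgn [series x n * y n]_n by [].
have [M yM] := (bounded_sequenceP y).1 (ellinftyP y).
have xs := ell1P x; rewrite inE /= in xs.
apply: normed_cvg.
apply: (@series_le_cvg _ _ (M *: (fun n => `|x n|))).
- by move=> n; exact: normr_ge0.
- by move=> n; rewrite mulr_ge0// (le_trans _ (yM 0%N)).
- by move=> n; rewrite /= normrM mulrC; exact: ler_wpM2r.
- exact: is_cvg_seriesZ.
Qed.

Lemma pairingE x y l : [series x n * y n]_n @ \oo --> l -> pairing x y = l.
Proof. by move=> h; apply/cvg_lim. Qed.

Lemma pairingBl x u y : pairing (x - u) y = pairing x y - pairing u y.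
Proof.
apply: pairingE; rewrite [X in X @ \oo --> _](_ : _ =
    [series x n * y n]_n - [series u n * y n]_n).
  by apply: cvgB; exact: cvg_pairing.
apply/funext => n; rewrite /series !fctE /= -sumrB.
by apply: eq_bigr => i _; rewrite -mulrBl.
Qed.

Lemma pairingBr x y w : pairing x (y - w) = pairing x y - pairing x w.
Proof.
apply: pairingE; rewrite [X in X @ \oo --> _](_ : _ =
    [series x n * y n]_n - [series x n * w n]_n).
  by apply: cvgB; exact: cvg_pairing.
apply/funext => n; rewrite /series !fctE /= -sumrB.
by apply: eq_bigr => i _; rewrite -mulrBr.
Qed.

Lemma pairing0r x : pairing x 0 = 0.
Proof. by have := pairingBr x 0 0; rewrite !subrr. Qed.

Lemma pairingNr x y : pairing x (- y) = - pairing x y.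
Proof. by rewrite -[- y]sub0r pairingBr pairing0r sub0r. Qed.

Lemma sum_single (f : nat -> R) n m : (n < m)%N ->
  (forall k, k != n -> f k = 0) -> \sum_(0 <= k < m) f k = f n.
Proof.
move=> nm f0; rewrite big_mkord (bigD1 (Ordinal nm))//= big1 ?addr0// => i.
by move=> ni; apply: f0; apply: contra ni => /eqP ni; apply/eqP/val_inj.
Qed.

Definition single_seq (a : R) (n : nat) : R^nat :=
  fun k => if k == n then a else 0.

Lemma single_seq_summable a n : single_seq a n \in @absolutely_summable R.
Proof.
rewrite inE /=; apply: (cvgP `|a|); apply: cvg_near_cst.
near=> m; rewrite [LHS](@sum_single (fun k => `|single_seq a n k|) n).
- by rewrite /single_seq eqxx.
- by near: m; exact: nbhs_infty_gt.
- by move=> k /negbTE kn; rewrite /single_seq kn normr0.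
Unshelve. all: by end_near. Qed.

Definition single a n : ell1 R := Ell1 (single_seq_summable a n).

Lemma pairing_single a n y : pairing (single a n) y = a * y n.
Proof.
apply: pairingE; apply: cvg_near_cst; near=> m; rewrite /series /=.
rewrite (@sum_single _ n).
- by rewrite /single_seq eqxx.
- by near: m; exact: nbhs_infty_gt.
- by move=> k /negbTE kn; rewrite /single_seq kn mul0r.
Unshelve. all: by end_near. Qed.

(** The multiples of a single unit vector already make a nonzero functional
    take every value. *)
Lemma pairing_surj y : y != 0 -> forall r, exists u, pairing u y = r.
Proof.
move=> y0 r.
have [n yn] : exists n, y n != 0.
  apply: contra_notP (negP y0) => /forallNP y0'; apply/eqP/val_inj/funext => n.
  by apply/eqP/negPn/negP/y0'.
by exists (single (r / y n) n); rewrite pairing_single divfK.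
Qed.

End Pairing.

Section Skew.
Variables (R : realType) (F : ell1 R -> ellinfty R).
Hypothesis skewF : forall u v, pairing u (F v) = - pairing v (F u).

Let A := graph (operator_of F).

Lemma skew_diag u : pairing u (F u) = 0.
Proof. by have := skewF u u; lra. Qed.

Lemma in_graph (z : ell1 R * ellinfty R) : (z \in A) = (z.2 - F z.1 == 0).
Proof. by rewrite subr_eq0; apply/idP/eqP; rewrite inE. Qed.

Lemma coupling_on_skew : coupling_on A = iota_ A.
Proof.
apply/funext => z; rewrite /coupling_on /iota_; case: ifPn => [|_].
  by rewrite in_graph subr_eq0 /coupling => /eqP ->; rewrite skew_diag adde0.
by rewrite addey.
Qed.

Lemma dot_skew z u : dot z (u, F u) = pairing u (z.2 - F z.1).
Proof. by rewrite /dot /= pairingBr skewF addrC. Qed.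

(** On the graph [z . (u, F u)] vanishes identically; off the graph it is a
    nonzero linear functional of [u], hence unbounded above. *)
Lemma conjugate_iota_skew : conjugate (iota_ A) = iota_ A.
Proof.
have gr u : (u, F u) \in A by rewrite in_graph subrr.
apply/funext => z; rewrite [RHS]/iota_ in_graph.
have [z0|z0] := eqVneq (z.2 - F z.1) 0.
  have dot0 u : dot z (u, F u) = 0
    by rewrite dot_skew z0 pairing0r.
  apply/eqP; rewrite eq_le; apply/andP; split.
    apply: ge_ereal_sup => _ [w _ <-]; rewrite /iota_; case: ifPn => [|_].
      by case: w => u v; rewrite in_graph subr_eq0 /= => /eqP ->; rewrite dot0 sube0.
    by rewrite addeNy leNye.
  by apply: ereal_sup_ubound; exists (0, F 0) => //; rewrite /iota_ gr dot0 sube0.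
apply/eqyP => r _; have [u ur] := pairing_surj z0 r.
by apply: ereal_sup_ubound; exists (u, F u) => //;
  rewrite /iota_ gr dot_skew ur sube0.
Qed.

Lemma pairing_sub_graph x y u :
  pairing (x - u) (y - F u) = pairing x y - pairing u (y - F x).
Proof. by rewrite pairingBl !pairingBr skew_diag (skewF x u); ring. Qed.

(** By [pairing_sub_graph], skewness makes the graph monotone, with equality,
    and turns the test of [(x, y)] against [(u, F u)] into an upper bound for a
    linear functional of [u]. *)
Lemma maximal_monotone_skew : maximal_monotone (operator_of F).
Proof.
split=> [z w -> ->|B monB AB].
  by rewrite pairing_sub_graph pairingBr !skew_diag skewF; lra.
apply/seteqP; split=> // -[x y] Bxy; rewrite -[graph _ _]/(A (x, y)).
apply/set_mem; rewrite in_graph /=; apply: contraT => yF.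
(* The value [<x, y> + 1] just violates the bound that monotonicity gives. *)
have [u ur] := pairing_surj yF (pairing x y + 1).
have := monB _ (u, F u) Bxy (AB (u, F u) erefl).
by rewrite /= pairing_sub_graph ur; lra.
Qed.

Lemma skew_summary :
  maximal_monotone (operator_of F) /\
  fitzpatrick A = psi A /\ psi A = iota_ A /\ iota_ A = coupling_on A.
Proof.
have fitzE : fitzpatrick A = iota_ A.
  by rewrite /fitzpatrick coupling_on_skew conjugate_iota_skew.
have psiE : psi A = iota_ A by rewrite /psi fitzE conjugate_iota_skew.
rewrite fitzE psiE coupling_on_skew.
by split; first exact: maximal_monotone_skew.
Qed.

End Skew.

Section GossezSkew.
Variable R : realType.
Implicit Types (u v : ell1 R).

(** With [S_n] the partial sums of [v] and [S] their limit, this is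
    [S - S_n - S_(n+1)]: a form free of tails and symmetric in the two sums
    around [n], which is what makes the series in [gossez_skew] telescope. *)
Lemma gossezE v n :
  gossez v n = limn (series v) - series v n - series v n.+1.
Proof.
rewrite /= /gossez_seq addrC addrAC; congr (_ - _).
apply/cvg_lim => //.
have tailE : series v m - series v n.+1 @[m --> \oo] -->
    limn (series v) - series v n.+1.
  by apply: cvgB; [exact: ell1_cvg_series | exact: cvg_cst].
apply: cvg_trans tailE; apply: near_eq_cvg; near=> m.
rewrite sub_series_geq//; near: m; exact: nbhs_infty_ge.
Unshelve. all: by end_near. Qed.

(** Summation by parts: since
    [(U' - U) (V + V') + (V' - V) (U + U') = 2 (U' V' - U V)] for consecutive
    partial sums [U, U'] of [u] and [V, V'] of [v], the quadratic part of the
    sum telescopes, and in the limit it cancels the part linear in the partial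
    sums. *)
Lemma gossez_skew u v : pairing u (gossez v) = - pairing v (gossez u).
Proof.
set U : R := limn (series u); set V : R := limn (series v).
have sumE N : [series u n * gossez v n]_n N + [series v n * gossez u n]_n N =
    series u N * V + series v N * U - 2 * (series u N * series v N).
  elim: N => [|N IH]; first by rewrite /series /= !big_geq//; ring.
  have seriesS (f : R^nat) : series f N.+1 = series f N + f N.
    by rewrite /series /= big_nat_recr.
  rewrite !seriesS addrACA IH /mk_sequence !gossezE !seriesS -/U -/V.
  ring.
have cvgU : series u @ \oo --> U by exact: ell1_cvg_series.
have cvgV : series v @ \oo --> V by exact: ell1_cvg_series.
have cvgUV : series u N * V + series v N * U - 2 * (series u N * series v N)
    @[N --> \oo] --> U * V + V * U - 2 * (U * V).
  apply: cvgB; last by apply: cvgM; [exact: cvg_cst | exact: cvgM].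
  by apply: cvgD; apply: cvgM => //; exact: cvg_cst.
have cvgG : [series u n * gossez v n]_n N + [series v n * gossez u n]_n N
    @[N --> \oo] --> pairing u (gossez v) + pairing v (gossez u).
  by apply: cvgD; exact: cvg_pairing.
rewrite (funext sumE) in cvgG.
apply/eqP; rewrite -addr_eq0; apply/eqP.
rewrite (cvg_unique _ cvgG cvgUV)//; ring.
Qed.

End GossezSkew.

Theorem theorem3 (R : realType) :
  let G := operator_of (@gossez R) in
  let nG := operator_of (@neg_gossez R) in
  (maximal_monotone G /\
   fitzpatrick (graph G) = psi (graph G) /\
   psi (graph G) = iota_ (graph G) /\
   iota_ (graph G) = coupling_on (graph G)) /\
  (maximal_monotone nG /\
   fitzpatrick (graph nG) = psi (graph nG) /\
   psi (graph nG) = iota_ (graph nG) /\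
   iota_ (graph nG) = coupling_on (graph nG)).
Proof.
split; apply: skew_summary => u v; first exact: gossez_skew.
by rewrite /neg_gossez !pairingNr gossez_skew.
Qed.
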